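(* For any distributive lattice $L$ there exists a set $M$ with two topological closures $\mathbf C_1,\mathbf C_2$ on $M$ such that $L$ is isomorphic, as a poset, to $\mathrm{C}_1\mathrm{O}_2(M,\mathbf C_1,\mathbf C_2)$ ordered by inclusion.
   Context: A closure on a set $M$ is a map $\mathbf C:\exp(M)\to\exp(M)$ on subsets of $M$ with $X\subset\mathbf C(X)$, $\mathbf C(\mathbf C(X))=\mathbf C(X)$, and $X\subset Y\Rightarrow\mathbf C(X)\subset\mathbf C(Y)$. A closure is topological if $\mathbf C(X\cup Y)=\mathbf C(X)\cup\mathbf C(Y)$ for all $X,Y\subset M$ (it is not required that $\mathbf C(\emptyset)=\emptyset$). A set $X$ is $\mathbf C$-closed if $X=\mathbf C(X)$ and $\mathbf C$-open if $M\setminus X$ is $\mathbf C$-closed. $\mathrm{C}_1\mathrm{O}_2(M,\mathbf C_1,\mathbf C_2)$ is the collection of all subsets of $M$ that are both $\mathbf C_1$-closed and $\mathbf C_2$-open, ordered by inclusion. Lattices are not assumed to be bounded. *)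

(* Defs.v *)
From mathcomp Require Import all_boot all_order.
From mathcomp Require Import boolp classical_sets functions.

Set Implicit Arguments.
Unset Strict Implicit.
Unset Printing Implicit Defensive.

Local Open Scope classical_set_scope.

Definition is_closure (M : Type) (C : set M -> set M) : Prop :=
  [/\ forall X : set M, X `<=` C X,
      forall X : set M, C (C X) = C X
    & forall X Y : set M, X `<=` Y -> C X `<=` C Y].

(* Weaker than a Kuratowski closure: C set0 may be nonempty. *)
Definition topological_closure (M : Type) (C : set M -> set M) : Prop :=
  is_closure C /\ forall X Y : set M, C (X `|` Y) = C X `|` C Y.

Definition closed_for (M : Type) (C : set M -> set M) (X : set M) : Prop :=
  X = C X.

Definition open_for (M : Type) (C : set M -> set M) (X : set M) : Prop :=
  closed_for C (~` X).

Definition C1O2 (M : Type) (C1 C2 : set M -> set M) : set (set M) :=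
  [set X | closed_for C1 X /\ open_for C2 X].

Definition poset_isomorphic_to_sets (d : Order.disp_t) (L : porderType d)
    (M : Type) (F : set (set M)) : Prop :=
  exists f : L -> set M,
    set_bij [set: L] F f /\
    forall x y : L, (x <= y)%O <-> f x `<=` f y.

(* Main.v *)
(** Represent x in L by the set of prime filters containing it.  The C1-closed
    sets are the intersections of representing sets, and the C2-open sets are
    the unions of representing sets.  If X is both the intersection over A and
    the union over B, then no prime filter contains A and misses B, so by the
    prime filter theorem the filter generated by A meets the ideal generated
    by B; any common element represents X.  Allowing the empty and the full
    set as prime filters makes this work without bounds, and even for the empty
    lattice. *)

Require Import Defs.
From mathcomp Require Import all_boot all_order.
From mathcomp Require Import boolp classical_sets functions.

Set Implicit Arguments.
Unset Strict Implicit.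
Unset Printing Implicit Defensive.

Import Order.TTheory.
Local Open Scope classical_set_scope.

Section ClosureOfFamily.
Variables (M : Type) (G : set (set M)).

Definition family_closure (X : set M) : set M :=
  \bigcap_(U in G `&` [set U | X `<=` U]) U.

(** A point outside the closures of [X] and [Y] is missed by some members [U] and [V] of [G]
    containing [X] and [Y]; then [U] ∪ [V] is a member that contains both sets and misses the
    point. *)
Lemma family_closure_topological :
  (forall U V, G U -> G V -> G (U `|` V)) ->
  topological_closure family_closure.
Proof.
move=> GU.
have sub X : X `<=` family_closure X by move=> p Xp U [_ XU]; exact: XU.
have mono X Y : X `<=` Y -> family_closure X `<=` family_closure Y.
  by move=> XY p Xp U [GU' YU]; apply: Xp; split=> //; apply: subset_trans YU.
split; first split=> // X.
  apply/seteqP; split=> // p CXp U [GU' XU]; apply: CXp; split=> // q CXq.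
  exact: CXq.
move=> X Y; apply/seteqP; split; last first.
  by move=> p [] ; apply: mono => q; [left|right].
move=> p XYp; apply: contrapT => /not_orP[].
move=> /existsNP[U /not_implyP[[GU' XU] Up]].
move=> /existsNP[V /not_implyP[[GV YV] Vp]].
suff [] : (U `|` V) p by [].
apply: XYp; split; first exact: GU.
by move=> q [/XU|/YV]; [left|right].
Qed.

End ClosureOfFamily.

Section PrimeFilters.
Local Open Scope order_scope.
Variables (d : Order.disp_t) (L : distrLatticeType d).
Implicit Types (A B F I P : set L) (x y z : L).

Definition lattice_filter F :=
  (forall x y, x <= y -> F x -> F y) /\
  (forall x y, F x -> F y -> F (x `&` y)).

Definition lattice_ideal I :=
  (forall x y, x <= y -> I y -> I x) /\
  (forall x y, I x -> I y -> I (x `|` y)).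

(* Neither nonemptiness nor properness is required. *)
Definition prime_filter P :=
  lattice_filter P /\ lattice_ideal (~` P).

(** Zorn's lemma gives a filter [P] maximal among those containing [F] and missing [I]. If [x] and
    [y] lie outside [P] but their join lies inside, maximality puts some [p] ∧ [x] and [q] ∧ [y]
    with [p], [q] in [P] into [I]; by distributivity ([p] ∧ [q]) ∧ ([x] ∨ [y]) is then in both [P]
    and [I]. *)
Lemma prime_filter_separation F I :
  lattice_filter F -> lattice_ideal I -> F `<=` ~` I ->
  exists P, [/\ prime_filter P, F `<=` P & P `<=` ~` I].
Proof.
move=> [Fup Fmeet] [Idown Ijoin] FI.
(* Adding F to the members makes the union of the empty chain admissible. *)
pose admissible Q := lattice_filter (F `|` Q)%classic /\ (F `|` Q)%classic `<=` ~` I.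
have [K KK totK|Q [[[Qup Qmeet] QI] Qmax]] := @Zorn_bigcup L admissible.
  split; last first.
    by move=> x [/FI//|[Q KQ Qx]]; apply: (KK _ KQ).2; right.
  split=> [x y xy [Fx|[Q KQ Qx]]|x y].
  - by left; exact: Fup Fx.
  - have [] := (KK _ KQ).1.1 _ _ xy (or_intror Qx); first by left.
    by move=> Qy; right; exists Q.
  - have inK Q : K Q -> (F `|` Q)%classic x -> (F `|` Q)%classic y ->
        (F `|` \bigcup_(X in K) X)%classic (x `&` y).
      move=> KQ Qx Qy; have [] := (KK _ KQ).1.2 _ _ Qx Qy; first by left.
      by move=> Qxy; right; exists Q.
    move=> [Fx|[Q KQ Qx]] [Fy|[Q' KQ' Qy]].
    + by left; exact: Fmeet.
    + by apply: (inK _ KQ'); [left|right].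
    + by apply: (inK _ KQ); [right|left].
    + have [QQ'|Q'Q] := totK _ _ KQ KQ'.
        by apply: (inK _ KQ'); right => //; exact: QQ'.
      by apply: (inK _ KQ); right => //; exact: Q'Q.
exists (F `|` Q)%classic; split=> [|x Fx|]; [|by left|by []].
set P := (F `|` Q)%classic in Qup Qmeet QI *.
have extend x y : P y -> ~ P x -> exists2 p, P p & I (p `&` x).
  move=> Py nPx; apply: contrapT => noI.
  (* [R] is the filter generated by [P] and [x]. It contains [x] because [P] is nonempty, as
     witnessed by [y]. *)
  pose R := [set z | exists2 p, P p & p `&` x <= z].
  have PR : P `<=` R by move=> p Pp; exists p => //; exact: leIl.
  have FR : (F `|` R)%classic = R.
    by apply/setUidPr => z Fz; apply: PR; left.
  apply: (Qmax R).
    split=> [z Qz|RQ]; first by apply: PR; right.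
    by apply: nPx; right; apply: RQ; exists y => //; exact: leIr.
  rewrite /admissible FR; split; first split.
  - by move=> u v uv [p Pp pu]; exists p => //; exact: le_trans uv.
  - move=> u v [p Pp pu] [q Pq qv]; exists (p `&` q); first exact: Qmeet.
    rewrite lexI (le_trans _ pu) ?(le_trans _ qv) // leI2 ?leIl ?leIr //.
  - by move=> u [p Pp pu] Iu; apply: noI; exists p => //; exact: Idown Iu.
split=> //; split=> [x y xy nPy Px|x y nPx nPy Pxy].
  by apply: nPy; exact: Qup Px.
have [p Pp Ipx] := extend x _ Pxy nPx.
have [q Pq Iqy] := extend y _ Pxy nPy.
apply: (QI ((p `&` q) `&` (x `|` y))); first exact/Qmeet/Pxy/Qmeet.
apply: Idown (Ijoin _ _ Ipx Iqy).
by rewrite meetUr leU2 // leI2 // ?leIl ?leIr.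
Qed.

(** As the empty set counts as a filter and as an ideal, the empty set generates itself, and no case
    distinction on empty [A] or [B] arises later. *)
Definition generated_filter A : set L :=
  \bigcap_(F in lattice_filter `&` [set F | A `<=` F]) F.

Definition generated_ideal B : set L :=
  \bigcap_(I in lattice_ideal `&` [set I | B `<=` I]) I.

Lemma generated_filterP A : lattice_filter (generated_filter A).
Proof.
split=> [x y xy Ax F FA|x y Ax Ay F FA].
  by apply: (FA.1.1 _ _ xy); exact: Ax.
by apply: FA.1.2; [exact: Ax|exact: Ay].
Qed.

Lemma generated_idealP B : lattice_ideal (generated_ideal B).
Proof.
split=> [x y xy By I IB|x y Bx By I IB].
  by apply: (IB.1.1 _ _ xy); exact: By.
by apply: IB.1.2; [exact: Bx|exact: By].
Qed.

Definition spectrum := {P : set L | prime_filter P}.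

Definition represent x : set spectrum := [set P | sval P x].

(** If [x] is not below [y], the principal filter of [x] and the principal ideal of [y] are
    disjoint, and a prime filter separates them. *)
Lemma represent_le x y : x <= y <-> represent x `<=` represent y.
Proof.
split=> [xy [P PP] Px|xy]; first exact: PP.1.1 Px.
apply: contrapT => nxy.
have [||z /= xz zy|P [PP xP Py]] :=
  @prime_filter_separation [set z | x <= z] [set z | z <= y].
- split=> [u v uv xu|u v xu xv] /=; first exact: le_trans uv.
  by rewrite lexI; apply/andP.
- split=> [u v uv vy|u v uy vy] /=; first exact: le_trans vy.
  by rewrite leUx; apply/andP.
- by apply: nxy; exact: le_trans zy.
apply: (Py y); last exact: lexx.
by apply: (xy (exist _ P PP)); apply: xP => /=.
Qed.

Lemma representU x y :
  represent (x `|` y) = (represent x `|` represent y)%classic.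
Proof.
apply/seteqP; split=> [[P PP] Pxy|[P PP] [Px|Py]].
- apply: contrapT => /not_orP[nPx nPy].
  exact: (PP.2.2 _ _ nPx nPy) Pxy.
- exact: PP.1.1 (leUl _ _) Px.
- exact: PP.1.1 (leUr _ _) Py.
Qed.

Lemma representI x y :
  represent (x `&` y) = (represent x `&` represent y)%classic.
Proof.
apply/seteqP; split=> [[P PP] Pxy|[P PP] [Px Py]]; last exact: PP.1.2.
by split; [exact: PP.1.1 (leIl _ _) Pxy|exact: PP.1.1 (leIr _ _) Pxy].
Qed.

Lemma represent_compact A B :
  \bigcap_(a in A) represent a = \bigcup_(b in B) represent b ->
  exists x, represent x = \bigcap_(a in A) represent a.
Proof.
move=> AB.
have [[x [Ax Bx]]|disj] :=
  pselect (exists x, generated_filter A x /\ generated_ideal B x).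
  exists x; apply/seteqP; split=> [[P PP] Px|[P PP] AP].
    (* If [P] missed [B], its complement would be an ideal containing [B], hence also [x]. *)
    rewrite AB; apply: contrapT => PB; apply: (Bx (setC P)) Px.
    by split=> [|b Bb Pb]; [exact: PP.2|apply: PB; exists b].
  by apply: Ax; split; [exact: PP.1|move=> a; exact: AP].
have [x Ax Bx|P [PP AP BP]] :=
  prime_filter_separation (generated_filterP A) (generated_idealP B).
  by apply: disj; exists x.
have : (\bigcap_(a in A) represent a) (exist _ P PP).
  by move=> a Aa; apply: AP => F [_]; exact.
rewrite AB => -[b Bb Pb]; exfalso.
by apply: (BP b Pb) => I [_]; exact.
Qed.

End PrimeFilters.

Theorem theorem10 (d : Order.disp_t) (L : distrLatticeType d) :
  exists (M : Type) (C1 C2 : set M -> set M),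
    [/\ topological_closure C1,
        topological_closure C2
      & poset_isomorphic_to_sets L (C1O2 C1 C2)].
Proof.
pose G1 := range (@represent d L).
(* Complements, because the open sets of the second closure are to be the unions of representing
   sets. *)
pose G2 := range (fun x : L => ~` represent x).
exists (spectrum L), (family_closure G1), (family_closure G2); split.
- apply: family_closure_topological => _ _ [x _ <-] [y _ <-].
  by exists (x `|` y)%O => //; exact: representU.
- apply: family_closure_topological => _ _ [x _ <-] [y _ <-].
  by exists (x `&` y)%O => //; rewrite representI setCI.
have closedG M (G : set (set M)) U : G U -> closed_for (family_closure G) U.
  by move=> GU; apply/seteqP; split=> [p Up V [_]|p]; [exact|apply; split].
exists (@represent d L); split; last exact: represent_le.
split=> [x _|x y _ _ xy|X [X1 X2]].
- by split; apply: closedG; exists x.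
- by apply/eqP; rewrite eq_le; apply/andP; split; apply/represent_le; rewrite xy.
pose A := [set a : L | X `<=` represent a].
pose B := [set b : L | represent b `<=` X].
have XA : X = \bigcap_(a in A) represent a.
  rewrite [LHS]X1; apply/seteqP; split=> [P XP a Aa|P AP _ [[a _ <-] Xa]].
    by apply: XP; split=> //; exists a.
  exact: AP.
have XB : X = \bigcup_(b in B) represent b.
  apply/seteqP; split=> [P XP|P [b Bb Pb]]; last exact: Bb.
  (* Each member of [G2] containing the complement of [X] is the complement of some [represent b]
     inside [X]. A point outside all such [represent b] is therefore in the closure of the
     complement of [X], which is that complement itself. *)
  apply: contrapT => PB.
  suff : (~` X) P by [].
  rewrite X2 => _ [[b _ <-] Xb] Pb; apply: PB; exists b => //.
  by move=> Q Qb; apply: contrapT => /Xb.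
have [|x xX] := @represent_compact d L A B; first by rewrite -XA.
by exists x => //; rewrite xX -XA.
Qed.
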